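(* Let $d\ge 2$ be an integer and $M$ be a positive integer. Consider the polynomials $P_{d,M}(x)$ of degree $d$ and height $M$ defined by $$P_{d,M}(x)=\begin{cases} Mx^2-x-1 & \text{if } d=2;\\ x^3+Mx^2-1 & \text{if } d=3;\\ x^d-(Mx^2-1)(1-x^{d-3}) & \text{if } d\ge 4 \text{ is even};\\ x^d-(M-1)x^{d-1}+x^{d-3}-Mx^3-Mx^2+x+1 & \text{if } d\ge 5 \text{ is odd}.\end{cases}$$ For every $d\geq 2$ there exist a constant $C_d>0$ and an integer $M_d$, both depending only on $d$, such that for every integer $M\ge M_d$ the polynomial $P_{d,M}(x)$ has two roots $\alpha,\beta\in\mathbb{R}$ such that $\big||\alpha|-|\beta|\big|=|\alpha+\beta|$ and $$0<|\alpha+\beta|\le C_d\,\mathrm{H}(P_{d,M})^{-d+1}.$$ For $d\ge 3$, the polynomials $P_{d,M}$ are monic and, if $M$ is sufficiently large in terms of $d$, irreducible over the field of rational numbers.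
   Context: The height $\mathrm{H}(P)$ of a polynomial $P$ with integer coefficients is the maximum of the absolute values of its coefficients. *)

(* Defs.v *)
From HB Require Import structures.
From mathcomp Require Import all_boot all_order all_algebra.
Set Implicit Arguments.
Unset Strict Implicit.
Unset Printing Implicit Defensive.
Import Order.TTheory GRing.Theory Num.Theory.
Local Open Scope ring_scope.

Definition height (P : {poly int}) : nat :=
  (\max_(i < size P) absz (P`_i)%R)%N.

(* Only meaningful for d >= 2: for d < 2 one of the last two branches applies,
   with truncated exponents. *)
Definition close_poly (d : nat) (M : int) : {poly int} :=
  if d == 2%N then M%:P * 'X^2 - 'X - 1
  else if d == 3%N then 'X^3 + M%:P * 'X^2 - 1
  else if ~~ odd d then 'X^d - (M%:P * 'X^2 - 1) * (1 - 'X^(d - 3))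
  else 'X^d - (M - 1)%:P * 'X^(d - 1) + 'X^(d - 3)
       - M%:P * 'X^3 - M%:P * 'X^2 + 'X + 1.

(* Main.v *)
Require Import Defs.
From HB Require Import structures.
From mathcomp Require Import all_boot all_order all_algebra all_field.
From Stdlib Require Import Classical.
From mathcomp Require Import reals zify ring lra.
Set Implicit Arguments.
Unset Strict Implicit.
Unset Printing Implicit Defensive.
Import Order.TTheory GRing.Theory Num.Theory.
Local Open Scope ring_scope.

(** Everything rests on one shape shared by all degrees: up to sign,
    P = (M X^2 - 1) u - v, where u and v do not depend on M, u(0) = 1,
    v(0) = 0, and, with e = 1 or e = -1,
      v(x) u(-x) - v(-x) u(x) = 2 e x^(2d-3)                             (W)
    ([close_poly_decomposition]). In other words w = v/u is even up to order
    2d-3, and P(x) = 0 reads M x^2 = 1 + w(x).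

    Real roots. Let s be the square root of M. The intermediate value theorem
    gives roots a > 0 and - g < 0 with a and g between 1/(2s) and 2/s. If w
    were even, a and g would satisfy the same equation; in general, subtracting
    the two equations and using (W),
      M (a^2 - g^2) u(a) u(-g) = 2 e g^(2d-3) + O(|a - g|).
    The left side is at least of order s |a - g|, which absorbs the error term,
    so |a - g| is O(s^(-(2d-2))) = O(M^(-(d-1))). It is not zero, since
    g^(2d-3) is not ([close_opposite_roots]).

    Irreducibility. Write P = A + M B. Up to sign A = u + v and B = X^2 u.
    They do not both vanish at 0, since u(0) + v(0) = 1; another common root
    would be common to u and v, against (W). Hence a nonconstant
    polynomial h divides A + M B for at most one M
    ([linear_family_common_divisor]). On the other hand, for d >= 3, the
    coefficient of X^(d-1) has absolute value at least M - 1, so some complex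
    root z satisfies |z| >= M/(2d) as soon as M >= 2. All coefficients of P are at most M in
    absolute value, so those of P / (X - z) are bounded independently of M,
    and so are all the other roots. In a factorization P = h r over the
    integers, the factor that does not have z as a root therefore belongs to a
    finite set depending on d only ([int_factor_bounded]). Finitely many
    candidates, each excluded for all M but one: for large M there is no
    factorization, and Gauss's lemma passes to the rationals
    ([irreducible_linear_family]). *)

(** * Nearly opposite real roots *)

Lemma poly_bounded_lipschitz (R : realFieldType) (p : {poly R}) :
  exists2 K : R, 1 <= K & forall x y : R, `|x| <= 1 -> `|y| <= 1 ->
    `|p.[x]| <= K /\ `|p.[x] - p.[y]| <= K * `|x - y|.
Proof.
elim/poly_ind: p => [|p c [K K1 bd]].
  exists 1 => // x y _ _; rewrite !horner0 subrr normr0 mul1r.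
  by split; rewrite ?normr_ge0 ?ler01.
exists (K *+ 2 + `|c|) => [|x y x1 y1].
  by have := normr_ge0 c; lra.
have [bx _] := bd x y x1 y1; have [by_ _] := bd y x y1 x1.
have [_ lxy] := bd x y x1 y1.
rewrite !hornerE; have c0 := normr_ge0 c; have D0 := normr_ge0 (x - y).
split.
  apply: le_trans (ler_normD _ _) _; rewrite lerD2r normrM.
  have : `|p.[x]| * `|x| <= K * 1 by apply: ler_pM.
  by lra.
have -> : p.[x] * x + c - (p.[y] * y + c)
          = (p.[x] - p.[y]) * x + p.[y] * (x - y) by ring.
apply: le_trans (ler_normD _ _) _; rewrite !normrM.
have h1 : `|p.[x] - p.[y]| * `|x| <= K * `|x - y| * 1 by apply: ler_pM.
have h2 : `|p.[y]| * `|x - y| <= K * `|x - y| by apply: ler_wpM2r.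
have h3 : 0 <= `|c| * `|x - y| by apply: mulr_ge0.
by lra.
Qed.

(** The factor s^2 x^2 - 1 is 3 at x = 2/s and -3/4 at x = 1/(2s), and there
    u dominates v, so the sign changes. *)
Lemma ivt_root_near_inv (R : rcfType) (u v : {poly R}) (s : R) :
    2 <= s ->
    (forall x, `|x| <= 2 / s -> 2^-1 <= u.[x] /\ `|v.[x]| <= 4^-1) ->
  exists2 x, 1 / (2 * s) <= x <= 2 / s &
    (s ^+ 2 * x ^+ 2 - 1) * u.[x] = v.[x].
Proof.
move=> s2 huv; have s0 : 0 < s by lra.
have si0 : 0 < s^-1 by rewrite invr_gt0.
have ss : s * s^-1 = 1 by rewrite divff // gt_eqF.
pose p := ((s ^+ 2)%:P * 'X ^+ 2 - 1) * u - v.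
have pE x : p.[x] = (s ^+ 2 * x ^+ 2 - 1) * u.[x] - v.[x] by rewrite /p !hornerE.
have ab : 1 / (2 * s) <= 2 / s by rewrite invfM; lra.
have [|x xab /rootP] := @poly_ivt _ p _ _ ab.
  have a1 : `|1 / (2 * s)| <= 2 / s.
    by rewrite ger0_norm // invfM; lra.
  have b1 : `|2 / s| <= 2 / s by rewrite ger0_norm; lra.
  have [ua va] := huv _ a1; have [ub vb] := huv _ b1.
  rewrite !pE.
  have -> : s ^+ 2 * (1 / (2 * s)) ^+ 2 = 1 / 4.
    by rewrite invfM; transitivity ((s * s^-1) ^+ 2 / 4); [field | rewrite ss]; lra.
  have -> : s ^+ 2 * (2 / s) ^+ 2 = 4.
    by transitivity ((s * s^-1) ^+ 2 * 4); [field | rewrite ss]; lra.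
  by move: va vb; rewrite !ler_norml => /andP[? ?] /andP[? ?]; apply/andP; lra.
by rewrite pE => /eqP; rewrite subr_eq0 => /eqP; exists x.
Qed.

(** The parameter s stands for the square root of M, and k for d - 2. Keeping u
    and v apart, instead of working with v/u, leaves an exact polynomial
    identity with no division. *)
Lemma close_opposite_roots (R : rcfType) (u v : {poly R}) (e : R) (k : nat) :
    u.[0] = 1 -> v.[0] = 0 -> `|e| = 1 ->
    (forall x, v.[x] * u.[- x] - v.[- x] * u.[x] = 2 * e * x ^+ k.*2.+1) ->
  exists s0 : R, forall s, s0 <= s -> 0 < s -> exists a g : R,
    [/\ 0 < a, 0 < g,
        (s ^+ 2 * a ^+ 2 - 1) * u.[a] = v.[a],
        (s ^+ 2 * g ^+ 2 - 1) * u.[- g] = v.[- g] &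
        0 < `|a - g| <= 2 ^+ (k.*2 + 5) / s ^+ (k.*2 + 2)].
Proof.
move=> u0 v0 e1 huv.
have [Ku Ku1 bu] := poly_bounded_lipschitz u.
have [Kv Kv1 bv] := poly_bounded_lipschitz v.
pose K := Ku + Kv; exists (16 * K ^+ 2) => s sK s0.
have K2 : 2 <= K by rewrite /K; lra.
have Ku0 : 0 <= Ku := le_trans ler01 Ku1.
have Kv0 : 0 <= Kv := le_trans ler01 Kv1.
have KuK : Ku <= K by rewrite lerDl.
have KvK : Kv <= K by rewrite lerDr.
have K0 : 0 <= K := le_trans Ku0 KuK.
have KK : K <= K ^+ 2 by rewrite expr2; nra.
have s8 : 8 * K <= s by lra.
have s2 : 2 <= s by lra.
have si0 : 0 < s^-1 by rewrite invr_gt0.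
have ss : s * s^-1 = 1 by rewrite divff // gt_eqF.
have le1 (x : R) : `|x| <= 2 / s -> `|x| <= 1.
  by move=> h; apply: le_trans h _; rewrite ler_pdivrMr //; lra.
have Ks : K * (2 / s) <= 1 / 4.
  by rewrite mulrA ler_pdivrMr //; lra.
have n01 : `|0 : R| <= 1 by rewrite normr0.
have near0 (x : R) : `|x| <= 2 / s -> 2^-1 <= u.[x] /\ `|v.[x]| <= 4^-1.
  move=> xs; have x1 := le1 _ xs.
  have [_ ux] := bu x 0 x1 n01; have [_ vx] := bv x 0 x1 n01.
  move: ux vx; rewrite u0 v0 !subr0 => ux vx.
  have h1 : Ku * `|x| <= K * (2 / s) by apply: ler_pM.
  have h2 : Kv * `|x| <= K * (2 / s) by apply: ler_pM.
  move: ux; rewrite ler_norml => /andP[ux _].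
  by split; [move: ux h1 Ks | move: vx h2 Ks]; clear; lra.
have [a /andP[a1 a2] Ea] := ivt_root_near_inv s2 near0.
have [|g /andP[g1 g2]] := @ivt_root_near_inv _ (u \Po - 'X) (v \Po - 'X) s s2.
  by move=> x xs; rewrite !horner_comp !hornerE; apply: near0; rewrite normrN.
rewrite !horner_comp hornerN hornerX => Eg.
have i0 : 0 < 1 / (2 * s) by rewrite divr_gt0 // mulr_gt0.
have a0 : 0 < a := lt_le_trans i0 a1.
have g0 : 0 < g := lt_le_trans i0 g1.
exists a, g; split => //.
have na : `|a| <= 2 / s by rewrite gtr0_norm.
have ng : `|g| <= 2 / s by rewrite gtr0_norm.
have nNg : `|- g| <= 2 / s by rewrite normrN.
have [bug lug] := bu a g (le1 _ na) (le1 _ ng).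
have [_ lvg] := bv a g (le1 _ na) (le1 _ ng).
have [bNu _] := bu (- g) 0 (le1 _ nNg) n01.
have [bNv _] := bv (- g) 0 (le1 _ nNg) n01.
have [ua _] := near0 _ na; have [ug _] := near0 _ nNg.
(* Difference of the two root equations, cross-multiplied by u(-g) and u(a). *)
have key : s ^+ 2 * (a + g) * (u.[a] * u.[- g]) * (a - g)
   = 2 * e * g ^+ k.*2.+1
     + ((v.[a] - v.[g]) * u.[- g] - v.[- g] * (u.[a] - u.[g])).
  by rewrite -huv -Ea -Eg; ring.
apply/andP; split.
  rewrite normr_gt0 subr_eq0; apply/negP => /eqP ag; move: key.
  rewrite ag !subrr !(mulr0, mul0r) subr0 addr0 => /eqP.
  rewrite eq_sym mulf_eq0 expf_eq0 (gt_eqF g0) andbF orbF mulf_eq0 pnatr_eq0 /=.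
  by rewrite -normr_eq0 e1 oner_eq0.
have D0 := normr_ge0 (a - g).
have upper : s / 4 * `|a - g| <= 2 * g ^+ k.*2.+1 + 2 * K ^+ 2 * `|a - g|.
  have h1 : s / 4 * `|a - g|
            <= `|s ^+ 2 * (a + g) * (u.[a] * u.[- g]) * (a - g)|.
    rewrite normrM ler_wpM2r //; apply: le_trans (ler_norm _).
    apply: ler_pM; rewrite ?invr_ge0 ?(ltW s0) //; last first.
      have -> : 4^-1 = 2^-1 * 2^-1 :> R by rewrite -invfM -natrM.
      by apply: ler_pM; rewrite ?invr_ge0.
    (* 1/(2s) + 1/(2s) = 1/s is the lower bound for a + g. *)
    have sE : s = s ^+ 2 * (1 / (2 * s) + 1 / (2 * s)).
      by field; rewrite gt_eqF.
    rewrite [leLHS]sE.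
    by apply: ler_wpM2l; [exact/exprn_ge0/ltW | exact: lerD].
  apply: le_trans h1 _; rewrite key; apply: le_trans (ler_normD _ _) _.
  apply: lerD.
    rewrite !normrM e1 mulr1 ger0_norm // ger0_norm //.
    by rewrite exprn_ge0 // ltW.
  apply: le_trans (ler_normB _ _) _; rewrite !normrM.
  have h2 : `|v.[a] - v.[g]| * `|u.[- g]| <= (K * `|a - g|) * K.
    apply: ler_pM => //; last exact: le_trans bNu KuK.
    by apply: le_trans lvg _; apply: ler_wpM2r.
  have h3 : `|v.[- g]| * `|u.[a] - u.[g]| <= K * (K * `|a - g|).
    apply: ler_pM => //; first exact: le_trans bNv KvK.
    by apply: le_trans lug _; apply: ler_wpM2r.
  have -> : 2 * K ^+ 2 * `|a - g| = K * `|a - g| * K + K * (K * `|a - g|) by ring.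
  exact: lerD.
(* s >= 16 K^2 absorbs the error term into half of the left-hand side. *)
have h4 : s / 8 * `|a - g| <= 2 * g ^+ k.*2.+1.
  have : 16 * K ^+ 2 * `|a - g| <= s * `|a - g| by apply: ler_wpM2r.
  by move: upper; clear; lra.
have h5 : g ^+ k.*2.+1 <= (2 / s) ^+ k.*2.+1.
  by rewrite lerXn2r ?nnegrE ?(ltW g0) // (le_trans (ltW g0)).
have -> : 2 ^+ (k.*2 + 5) / s ^+ (k.*2 + 2) = 16 / s * (2 / s) ^+ k.*2.+1.
  rewrite expr_div_n !exprS !exprD; field.
  by rewrite expf_neq0 gt_eqF.
have -> : `|a - g| = 8 / s * (s / 8 * `|a - g|) by field; rewrite gt_eqF.
have -> : 16 / s * (2 / s) ^+ k.*2.+1 = 8 / s * (2 * (2 / s) ^+ k.*2.+1).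
  by field; rewrite gt_eqF.
apply: ler_wpM2l; first by rewrite divr_ge0 // ltW.
by apply: le_trans h4 _; rewrite ler_pM2l.
Qed.

(** * Bounding one factor of an integer polynomial with a large root *)

(** Synthetic division by X - z run from the constant term upwards divides by z at
    each step; when |z| is large this contracts, so that the bound K propagates. *)
Lemma coef_quotient_XsubC_le (F : numFieldType) (q : {poly F}) (z H K : F) :
    0 <= K -> 0 <= H -> H + K <= K * `|z| ->
    (forall i, `|(q * ('X - z%:P))`_i| <= H) ->
  forall i, `|q`_i| <= K.
Proof.
move=> K0 H0 HK hc.
(* For z = 0 the hypothesis on H and K forces H = 0, so q = 0. *)
have [z0|z0] := eqVneq z 0.
  move: HK hc; rewrite z0 normr0 mulr0 => HK hc i.
  have H00 : H <= 0 by apply: le_trans HK; rewrite lerDl.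
  have := hc i.+1; rewrite subr0 coefMX /= => /le_trans -> //.
  exact: le_trans H00 K0.
have nz0 : 0 < `|z| by rewrite normr_gt0.
elim=> [|i IH].
  have := hc 0%N; rewrite mulrBr coefB coefMX coefMC /= sub0r normrN normrM => c0.
  rewrite -(ler_pM2r nz0); apply: le_trans c0 _.
  by apply: le_trans HK; rewrite lerDl.
rewrite -(ler_pM2r nz0) -normrM.
have -> : q`_i.+1 * z = q`_i - (q * ('X - z%:P))`_i.+1.
  by rewrite mulrBr coefB coefMX coefMC /= opprB addrC subrK.
apply: le_trans (ler_normB _ _) _; apply: le_trans HK.
by rewrite [leRHS]addrC; apply: lerD.
Qed.

(** For |z| > 1 the equation q(z) = 0 bounds |z|^n by n K |z|^(n-1). *)
Lemma root_monic_le (F : numFieldType) (q : {poly F}) (n : nat) (K z : F) :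
    q \is monic -> size q = n.+1 -> 0 <= K -> (forall i, `|q`_i| <= K) ->
  root q z -> `|z| <= 1 + n%:R * K.
Proof.
move=> qm sq K0 hc /rootP; rewrite horner_coef sq big_ord_recr /=.
have -> : q`_n = 1 by move/monicP: qm; rewrite /lead_coef sq.
rewrite mul1r addrC => /eqP; rewrite addr_eq0 => /eqP zn.
have nK : 0 <= n%:R * K by rewrite mulr_ge0.
have [z1|z1] := real_leP (normr_real z) (@real1 F).
  by apply: le_trans z1 _; rewrite lerDl.
have z0 : 0 < `|z| := lt_trans ltr01 z1.
case: n sq zn nK => [|n] sq zn nK.
  by move: zn => /eqP; rewrite big_ord0 oppr0 expr0 oner_eq0.
have : `|z| ^+ n.+1 <= n.+1%:R * K * `|z| ^+ n.
  rewrite -normrX zn normrN; apply: le_trans (ler_norm_sum _ _ _) _.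
  rewrite -[n.+1 in leRHS]card_ord -mulrA mulr_natl -sumr_const.
  apply: ler_sum => i _; rewrite normrM normrX; apply: ler_pM => //.
    exact: exprn_ge0.
  by apply: ler_weXn2l; [exact: ltW | rewrite -ltnS].
rewrite exprS ler_pM2r ?exprn_gt0 // => /le_trans -> //.
by rewrite lerDr.
Qed.

Lemma coef_prod_XsubC_le (F : numFieldType) (s : seq F) (B : F) :
    0 <= B -> (forall z, z \in s -> `|z| <= B) ->
  forall i, `|(\prod_(z <- s) ('X - z%:P))`_i| <= (1 + B) ^+ size s.
Proof.
move=> B0; elim: s => [|z s IH] hs i.
  by rewrite big_nil coef1 /= expr0; case: (i == 0)%N; rewrite ?normr1 ?normr0.
have zB : `|z| <= B by apply: hs; rewrite inE eqxx.
have {}IH := IH (fun y ys => hs y (ltac:(by rewrite inE ys orbT))).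
have P0 : 0 <= (1 + B) ^+ size s by rewrite exprn_ge0 // addr_ge0.
rewrite big_cons mulrBl coefB mulrC coefMX coefCM exprS mulrDl mul1r.
apply: le_trans (ler_normB _ _) _; apply: lerD.
  by case: eqP => _; rewrite ?normr0.
by rewrite normrM; apply: ler_pM.
Qed.

(** Applied to the sum of the roots, which a coefficient of the polynomial
    controls, this yields a large root without locating it. *)
Lemma exists_large_root (F : numFieldType) (s : seq F) (H : F) :
    0 < H -> H <= `|\sum_(z <- s) z| ->
  exists2 z, z \in s & H <= (size s)%:R * `|z|.
Proof.
move=> H0 hs; apply/hasP; apply: contraTT hs => /hasPn small.
have n0 : 0 <= (size s)%:R :> F by [].
rewrite -real_ltNge ?normr_real ?(gtr0_real H0) //.
apply: le_lt_trans (ler_norm_sum _ _ _) _.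
case: s small n0 => [|y s] small n0; first by rewrite big_nil.
have sn0 : 0 < (size (y :: s))%:R :> F by rewrite ltr0n.
have -> : H = \sum_(z <- y :: s) (H / (size (y :: s))%:R).
  rewrite big_const_seq count_predT iter_addr_0 -[RHS]mulr_natr mulfVK //.
  by rewrite gt_eqF.
rewrite [ltLHS]big_seq [ltRHS]big_seq; apply: ltr_sum.
  by apply/hasP; exists y => //; rewrite mem_head.
move=> z zs; rewrite ltr_pdivlMr // mulrC.
by have := small _ zs; rewrite -real_ltNge // ?realM ?realn ?normr_real ?(gtr0_real H0).
Qed.

(** Here s and t are the roots of the two factors of a monic polynomial of degree
    at most n and height at most H, with H of the order of M. Dividing out the
    large root y leaves coefficients at most 4n, hence roots at most 1 + 4n^2;
    those of the factor without y are among them, which bounds its coefficients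
    independently of H. *)
Lemma coef_without_large_root_le (F : numFieldType) (s t : seq F) (y H : F) (n : nat) :
    y \in s -> (size (s ++ t) <= n)%N -> 4 * n%:R <= H ->
    H <= 2 * n%:R * `|y| ->
    (forall i, `|(\prod_(z <- s ++ t) ('X - z%:P))`_i| <= H) ->
  forall i, `|(\prod_(z <- t) ('X - z%:P))`_i| <= (2 + 4 * n%:R ^+ 2) ^+ n.
Proof.
move=> ys sn nH Hy hc i.
have {ys s sn hc} [s sn hc] : exists2 s, (size ((y :: s) ++ t) <= n)%N &
    forall i, `|(\prod_(z <- (y :: s) ++ t) ('X - z%:P))`_i| <= H.
  have prm : perm_eq (s ++ t) ((y :: rem y s) ++ t).
    by rewrite perm_cat2r perm_to_rem.
  by exists (rem y s) => [|j]; rewrite -?(perm_size prm) -?(perm_big _ prm).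
have n0 : (0 < n)%N by apply: leq_trans sn.
set K : F := 4 * n%:R.
have nR : 0 < n%:R :> F by rewrite ltr0n.
have K0 : 0 < K by rewrite mulr_gt0.
have H0 : 0 < H by apply: lt_le_trans nH.
have HK : H + K <= K * `|y|.
  apply: le_trans (_ : H + H <= _); first by rewrite lerD2l.
  have -> : K * `|y| = 2 * (2 * n%:R * `|y|) by rewrite /K; ring.
  by rewrite -[H + H]mulr2n -[H *+ 2]mulr_natl ler_pM2l.
have qK : forall i, `|(\prod_(z <- s ++ t) ('X - z%:P))`_i| <= K.
  apply: (coef_quotient_XsubC_le (ltW K0) (ltW H0) HK) => j.
  by have := hc j; rewrite cat_cons big_cons mulrC.
have B0 : 0 <= 1 + n%:R * K by rewrite addr_ge0 // mulr_ge0 // ltW.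
have rootsB z : z \in t -> `|z| <= 1 + n%:R * K.
  move=> zt.
  apply: le_trans (root_monic_le _ (size_prod_XsubC _ _) (ltW K0) qK _) _.
  - exact: monic_prod_XsubC.
  - by rewrite root_prod_XsubC mem_cat zt orbT.
  rewrite lerD2l ler_wpM2r ?(ltW K0) // ler_nat.
  by apply: leq_trans sn; rewrite /= leqnSn.
apply: le_trans (coef_prod_XsubC_le B0 rootsB i) _.
have -> : 2 + 4 * n%:R ^+ 2 = 1 + (1 + n%:R * K) by rewrite /K; ring.
apply: ler_weXn2l; first by rewrite lerDl.
by apply: leq_trans sn; rewrite /= size_cat; lia.
Qed.

Lemma lead_coef_unit_int (h r : {poly int}) :
  h * r \is monic -> `|lead_coef h| = 1 /\ `|lead_coef r| = 1.
Proof.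
rewrite monicE lead_coefM => /eqP /(congr1 absz); rewrite abszM absz1.
by move=> /eqP; rewrite muln_eq1 => /andP[/eqP h1 /eqP r1]; rewrite -!abszE h1 r1.
Qed.

(** The large root belongs to one of the two factors; the other one is then
    bounded by a quantity that depends on the degree only. *)
Lemma int_factor_bounded (h r : {poly int}) (d : nat) (H : int) :
    h * r \is monic -> (0 < d)%N -> size (h * r) = d.+1 -> 4 * d%:Z <= H -> 0 < H ->
    (forall i, `|(h * r)`_i| <= H) -> H <= 2 * `|(h * r)`_d.-1| ->
  (forall i, `|h`_i| <= (2 + 4 * d%:Z ^+ 2) ^+ d) \/
  (forall i, `|r`_i| <= (2 + 4 * d%:Z ^+ 2) ^+ d).
Proof.
move=> mon d0 sz dH H0 hc hd.
have inj := @intr_inj algC.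
have [lh lr] := lead_coef_unit_int mon.
pose toC := map_poly (intr : int -> algC).
have leadC (q : {poly int}) : lead_coef (toC q) = (lead_coef q)%:~R.
  by rewrite lead_coef_map_inj.
have [s hs] := closed_field_poly_normal (toC h).
have [t ht] := closed_field_poly_normal (toC r).
rewrite leadC in hs; rewrite leadC in ht.
have pE : toC (h * r) = \prod_(z <- s ++ t) ('X - z%:P).
  rewrite /toC rmorphM /= -/toC hs ht -scalerAl -scalerAr scalerA -rmorphM /=.
  by rewrite -lead_coefM (monicP mon) scale1r big_cat.
have sst : size (s ++ t) = d.
  have := congr1 (fun p : {poly algC} => size p) pE.
  by rewrite size_prod_XsubC size_map_inj_poly // sz => -[].
have cC i : (\prod_(z <- s ++ t) ('X - z%:P))`_i = ((h * r)`_i)%:~R :> algC.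
  by rewrite -pE coef_map.
have norm_int (k : int) : `|k%:~R| = `|k|%:~R :> algC by rewrite intr_norm.
have HC i : `|(\prod_(z <- s ++ t) ('X - z%:P))`_i| <= H%:~R :> algC.
  by rewrite cC norm_int ler_int.
have [||z zst zH] := @exists_large_root _ (s ++ t) (H%:~R / 2).
- by rewrite divr_gt0 // ltr0z.
- rewrite -normrN -coefPn_prod_XsubC; last by rewrite sst -lt0n.
  rewrite sst cC norm_int ler_pdivrMr // mulrC.
  by rewrite -[2]/(2%:~R) -intrM ler_int.
have zH2 : H%:~R <= 2 * d%:R * `|z|.
  by rewrite -mulrA mulrC -ler_pdivrMr // -sst.
have dHC : 4 * d%:R <= H%:~R :> algC.
  by rewrite -[4]/(4%:~R) -[d%:R]/(d%:Z%:~R) -intrM ler_int.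
have backZ (q : {poly int}) (w : seq algC) : `|lead_coef q| = 1 ->
    toC q = (lead_coef q)%:~R *: \prod_(z <- w) ('X - z%:P) ->
    (forall i, `|(\prod_(z <- w) ('X - z%:P))`_i| <= (2 + 4 * d%:R ^+ 2) ^+ d :> algC) ->
    forall i, `|q`_i| <= (2 + 4 * d%:Z ^+ 2) ^+ d.
  move=> lq qE hw i; rewrite -(ler_int algC) -norm_int -coef_map /= -/toC qE.
  rewrite coefZ normrM norm_int lq mul1r; apply: le_trans (hw i) _.
  by rewrite rmorphXn rmorphD rmorphM rmorphXn.
move: zst; rewrite mem_cat => /orP[zs|zt]; [right|left].
  apply: (backZ _ _ lr ht); apply: (coef_without_large_root_le zs _ dHC zH2) => //.
  by rewrite sst.
apply: (backZ _ _ lh hs); apply: (coef_without_large_root_le zt _ dHC zH2).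
  by rewrite size_cat addnC -size_cat sst.
by move=> i; rewrite (perm_big (s ++ t)) // perm_catC.
Qed.

(** There are only finitely many integer polynomials of bounded size and bounded
    coefficients, so bounds found for each of them separately have a maximum. *)
Lemma bound_over_bounded_polys (n K : nat) (Q : {poly int} -> int -> Prop) :
    (forall h, exists b : int, forall M, Q h M -> M <= b) ->
  exists b : int, forall (h : {poly int}) M,
    (size h <= n)%N -> (forall i, `|h`_i| <= K%:Z) -> Q h M -> M <= b.
Proof.
move=> hQ.
(* Shifting coefficients by K makes them natural numbers at most 2K. *)
pose dec (c : 'rV['I_K.*2.+1]_n) : {poly int} :=
  rVpoly (map_mx (fun a : 'I_K.*2.+1 => a%:Z - K%:Z) c).
have [b hb] := fin_all_exists (fun c => hQ (dec c)).
exists (\sum_c `|b c|) => h M sh hK QM.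
pose c : 'rV['I_K.*2.+1]_n := \row_(i < n) inord (absz (h`_i + K%:Z)).
have hE : h = dec c.
  rewrite -[LHS](poly_rV_K sh) /dec; congr rVpoly; apply/rowP => i.
  rewrite !mxE inordK; have := hK i; rewrite ler_norml => /andP[? ?].
    by rewrite gez0_abs ?addrK //; lia.
  by rewrite -ltz_nat; lia.
rewrite hE in QM; apply: le_trans (hb _ _ QM) _.
apply: le_trans (ler_norm _) _; rewrite (bigD1 c) //= lerDl.
by apply: sumr_ge0.
Qed.

(** A root z of h satisfies A(z) + M B(z) = A(z) + N B(z) = 0; if M and N
    differ, then A(z) = B(z) = 0. *)
Lemma linear_family_common_divisor (A B h r r' : {poly int}) (M N : int) :
    (forall z : algC, root (map_poly intr A) z -> ~~ root (map_poly intr B) z) ->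
    size h != 1%N -> A + M *: B = h * r -> A + N *: B = h * r' -> M = N.
Proof.
move=> noroot sh hM hN; apply/eqP; apply: contraT => MN.
have inj := @intr_inj algC.
have /closed_rootP[z /rootP hz] : size (map_poly (intr : int -> algC) h) != 1%N.
  by rewrite size_map_inj_poly.
have ev (L : int) (w : {poly int}) : A + L *: B = h * w ->
    (map_poly intr A).[z] + L%:~R * (map_poly intr B).[z] = 0.
  move=> /(congr1 (fun p => (map_poly (intr : int -> algC) p).[z])).
  by rewrite rmorphD rmorphM /= map_polyZ !hornerE hz mul0r.
have eM := ev _ _ hM; have eN := ev _ _ hN.
have Bz : (map_poly (intr : int -> algC) B).[z] = 0.
  have /eqP : (M - N)%:~R * (map_poly intr B).[z] = 0 :> algC.
    by rewrite rmorphB mulrBl -[RHS](subrr (0 : algC)) -{1}eM -eN; ring.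
  by rewrite mulf_eq0 intr_eq0 subr_eq0 (negPf MN) => /eqP.
have Az : root (map_poly (intr : int -> algC) A) z.
  by apply/rootP; move: eM; rewrite Bz mulr0 addr0.
by have := noroot _ Az; rewrite /root Bz eqxx.
Qed.

(** A reducible member of the family has a nonconstant factor in a finite set that
    depends on d only, and each element of that set divides at most one member.
    Excluded middle decides which of them divide some member, so the threshold is
    not explicit. *)
Lemma irreducible_linear_family (A B : {poly int}) (d : nat) (m : int) :
    (0 < d)%N ->
    (forall z : algC, root (map_poly intr A) z -> ~~ root (map_poly intr B) z) ->
    (forall M, m <= M ->
      [/\ A + M *: B \is monic, size (A + M *: B) = d.+1,
          forall i, `|(A + M *: B)`_i| <= M & M <= 2 * `|(A + M *: B)`_d.-1|]) ->
  exists M0, forall M, M0 <= M ->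
    irreducible_poly (map_poly (intr : int -> rat) (A + M *: B)).
Proof.
move=> d0 noroot hP.
pose Q (h : {poly int}) M := (1 < size h)%N /\ exists r, A + M *: B = h * r.
have [h|b hb] := @bound_over_bounded_polys d.+1 ((2 + 4 * d ^ 2) ^ d)%N Q.
  have [[M [sh [r hr]]]|no] := classic (exists M, Q h M); last first.
    by exists 0 => M QM; case: no; exists M.
  exists M => N [_ [r' hr']].
  by rewrite (linear_family_common_divisor noroot _ hr hr') // neq_ltn sh orbT.
exists (`|m| + `|b| + 4 * d%:Z + 1) => M M0.
have [|mon sz hc hd] := hP M; first by lia.
have inj := @intr_inj rat.
split; first by rewrite size_map_inj_poly // sz ltnS.
move=> q sq /dvdpP_rat_int[h [a a0 qE] [r pE]].
have sh : size q = size h by rewrite qE size_scale // size_map_inj_poly.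
have p0 : h * r != 0 by rewrite -pE monic_neq0.
have h0 : h != 0 by apply: contraNneq p0 => ->; rewrite mul0r.
have r0 : r != 0 by apply: contraNneq p0 => ->; rewrite mulr0.
have szM : (size h + size r = d.+2)%N.
  by have := size_mul h0 r0; rewrite -pE sz; case: (_ + _)%N => //= k ->.
have [r1|r1] := leqP (size r) 1.
  have /size_poly1P[c c0 rE] : size r == 1%N.
    by rewrite eqn_leq r1 size_poly_gt0.
  rewrite pE qE rE rmorphM /= map_polyC /= mulrC mul_polyC.
  apply: eqp_trans (eqp_scale _ a0) _; rewrite eqp_sym.
  by apply: eqp_scale; rewrite intr_eq0.
have h1 : (1 < size h)%N.
  by rewrite ltn_neqAle size_poly_gt0 h0 andbT eq_sym -sh.
suff : M <= b by lia.
have KE : (2 + 4 * d%:Z ^+ 2) ^+ d = ((2 + 4 * d ^ 2) ^ d)%N%:Z.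
  by rewrite -(natz d) -[RHS]natz natrX natrD natrM natrX.
rewrite pE in mon sz hc hd.
have [||hK|rK] := int_factor_bounded mon d0 sz _ _ hc hd; try lia.
- apply: (hb h) => [|i|]; [lia | by rewrite -KE | by split=> //; exists r].
- apply: (hb r) => [|i|]; [lia | by rewrite -KE | split=> //; exists h].
  by rewrite mulrC.
Qed.

(** * The polynomials at hand *)

(** For d = 5 the monomials X^(d-3) and X^2 coincide and their joint coefficient
    is 1 - M, so from degree 5 on the witness for odd degrees is X^3, whose
    coefficient is always - M; in the other degrees it is X^2. *)
Lemma close_poly_coefs (d : nat) (M : int) : (2 <= d)%N -> 0 < M ->
  [/\ forall i, `|(close_poly d M)`_i| <= M,
      exists i, `|(close_poly d M)`_i| = M,
      forall i, (d < i)%N -> (close_poly d M)`_i = 0,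
      (close_poly d M)`_d = (if d == 2%N then M else 1) &
      (3 <= d)%N -> M <= `|(close_poly d M)`_d.-1| + 1].
Proof.
move=> d2 M0.
have [->|dn2] := eqVneq d 2%N.
  have c i : (close_poly 2 M)`_i = M *+ (i == 2)%N - (i == 1)%:R - (i == 0)%:R.
    by rewrite /close_poly /= !coefE mulr_natr.
  split.
  - by move=> i; rewrite c; move: i => [|[|[|i]]] /=; lia.
  - by exists 2%N; rewrite c /=; lia.
  - by move=> i i2; rewrite c; move: i i2 => [|[|[|i]]] //=; lia.
  - by rewrite c /=; lia.
  - by [].
have [->|dn3] := eqVneq d 3%N.
  have c i : (close_poly 3 M)`_i = (i == 3)%:R + M *+ (i == 2)%N - (i == 0)%:R.
    by rewrite /close_poly /= !coefE mulr_natr.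
  split.
  - by move=> i; rewrite c; move: i => [|[|[|[|i]]]] /=; lia.
  - by exists 2%N; rewrite c /=; lia.
  - by move=> i i2; rewrite c; move: i i2 => [|[|[|[|i]]]] //=; lia.
  - by rewrite c /=; lia.
  - by rewrite c /=; lia.
have [od|ed] := boolP (odd d).
  have c i : (close_poly d M)`_i = (i == d)%:R - (M - 1) *+ (i == d - 1)%N
     + (i == d - 3)%N%:R - M *+ (i == 3)%N - M *+ (i == 2)%N
     + (i == 1)%N%:R + (i == 0)%N%:R.
    by rewrite /close_poly (negPf dn2) (negPf dn3) od /= !coefE !mulr_natr.
  have d5 : (5 <= d)%N by lia.
  split.
  - by move=> i; rewrite c; repeat (case: eqVneq => /= ?); lia.
  - by exists 3%N; rewrite c; repeat (case: eqVneq => /= ?); lia.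
  - by move=> i id; rewrite c; repeat (case: eqVneq => /= ?); lia.
  - by rewrite c; repeat (case: eqVneq => /= ?); lia.
  - by rewrite c; repeat (case: eqVneq => /= ?); lia.
have d4 : (4 <= d)%N by lia.
have c i : (close_poly d M)`_i = (i == d)%:R - M *+ (i == 2)%N
     + M *+ (i == d - 1)%N + (i == 0)%N%:R - (i == d - 3)%N%:R.
  rewrite /close_poly (negPf dn2) (negPf dn3) ed /=.
  have -> : 'X^d - (M%:P * 'X^2 - 1) * (1 - 'X^(d - 3))
     = 'X^d - M%:P * 'X^2 + M%:P * 'X^(d - 1) + 1 - 'X^(d - 3).
    have -> : (d - 1 = 2 + (d - 3))%N by lia.
    by rewrite exprD; ring.
  by rewrite !coefE !mulr_natr.
split.
- by move=> i; rewrite c; repeat (case: eqVneq => /= ?); lia.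
- by exists 2%N; rewrite c; repeat (case: eqVneq => /= ?); lia.
- by move=> i id; rewrite c; repeat (case: eqVneq => /= ?); lia.
- by rewrite c; repeat (case: eqVneq => /= ?); lia.
- by rewrite c; repeat (case: eqVneq => /= ?); lia.
Qed.

Lemma close_poly_size (d : nat) (M : int) : (2 <= d)%N -> 0 < M ->
  size (close_poly d M) = d.+1.
Proof.
move=> d2 M0; have [_ _ hi hd _] := close_poly_coefs d2 M0.
apply/eqP; rewrite eqn_leq; apply/andP; split; first exact/leq_sizeP.
rewrite ltnNge; apply/negP => /(nth_default 0) /eqP; apply/negP.
by rewrite hd; case: (d == 2%N) => //; rewrite gt_eqF.
Qed.

Lemma close_poly_height (d : nat) (M : int) : (2 <= d)%N -> 0 < M ->
  (height (close_poly d M))%:Z = M.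
Proof.
move=> d2 M0; have [hc [i hi] _ _ _] := close_poly_coefs d2 M0.
rewrite -[RHS](gtz0_abs M0); congr (Posz _); apply/eqP; rewrite eqn_leq.
apply/andP; split.
  by apply/bigmax_leqP => j _; rewrite -lez_nat !abszE (gtr0_norm M0).
have iP : (i < size (close_poly d M))%N.
  by rewrite ltnNge; apply/negP => /(nth_default 0) i0; move: hi; rewrite i0; lia.
apply: leq_trans (leq_bigmax_cond (Ordinal iP) isT).
by rewrite -lez_nat !abszE hi (gtr0_norm M0).
Qed.

Lemma close_poly_monic (d : nat) (M : int) : (3 <= d)%N -> 0 < M ->
  close_poly d M \is monic.
Proof.
move=> d3 M0; have [_ _ _ hd _] := close_poly_coefs (ltnW d3) M0.
rewrite monicE /lead_coef (close_poly_size (ltnW d3) M0) -pred_Sn hd.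
by rewrite gtn_eqF.
Qed.

(** The common shape. For odd d it comes from grouping
      P = (1 - M X^2)(1 + X + X^(d-3)) + X^(d-1) (1 + X);
    in the other cases it can be read off the definition. The identity says that
    v/u agrees with an even function up to order 2d - 3, the order that fixes the
    gap between the absolute values of the two roots. *)
Lemma close_poly_decomposition (d : nat) : (2 <= d)%N ->
  exists u v : {poly int}, exists sg e : int,
  [/\ u.[0] = 1, v.[0] = 0, `|sg| = 1 /\ `|e| = 1,
      v * (u \Po - 'X) - (v \Po - 'X) * u = (2 * e)%:P * 'X^((d - 2).*2.+1) &
      forall M, close_poly d M = sg%:P * ((M%:P * 'X^2 - 1) * u - v)].
Proof.
move=> d2.
have [->|dn2] := eqVneq d 2%N.
  exists 1, 'X, 1, 1; split => //; rewrite ?hornerE //.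
    by rewrite -[1]/(1%:P) !comp_polyC comp_polyX; ring.
  by move=> M; rewrite /close_poly /=; ring.
have [->|dn3] := eqVneq d 3%N.
  exists 1, (- 'X^3), 1, (-1); split => //; rewrite ?hornerE //=.
    rewrite -[1]/(1%:P) !(comp_polyC, comp_polyX, rmorphN, rmorphXn) /=.
    by rewrite !(comp_polyC, comp_polyX, rmorphN, rmorphXn) /=; ring.
  by move=> M; rewrite /close_poly /=; ring.
have [n dE] : exists n, d = n.+4 by exists (d - 4)%N; lia.
have e3 : (d - 3 = n.+1)%N by lia.
have e1 : (d - 1 = n.+3)%N by lia.
have e2 : ((d - 2).*2.+1 = n + n + 5)%N by lia.
have comp1 : 1 \Po - 'X = 1 :> {poly int} by rewrite -[1]/(1%:P) comp_polyC.
have powN (m : nat) : (- 'X) ^+ m = (-1) ^+ (odd m) * 'X^m :> {poly int}.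
  by rewrite [LHS]exprNn signr_odd.
have [od|ed] := boolP (odd d).
  exists (1 + 'X + 'X^(d - 3)), ('X^(d - 1) * (1 + 'X)), (-1), 1; split => //.
  - by rewrite !hornerE e3 expr0n /=; lia.
  - by rewrite !hornerE e1 expr0n.
  - rewrite e2 e1 e3 !(comp_polyD, comp_Xn_poly, comp_polyM, comp1, comp_polyX).
    have [o3 o1] : odd n.+3 = false /\ odd n.+1 = false by lia.
    by rewrite !powN o3 o1 !exprD !exprS; ring.
  - move=> M; rewrite /close_poly (negPf dn2) (negPf dn3) od e1 e3 dE !exprS; ring.
exists (1 - 'X^(d - 3)), ('X^d), (-1), 1; split => //.
- by rewrite !hornerE e3 expr0n.
- by rewrite !hornerE dE expr0n.
- rewrite e2 e3 dE !(comp_polyB, comp1, comp_Xn_poly).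
  have [o4 o1] : odd n.+4 = false /\ odd n.+1 = true by lia.
  by rewrite !powN o4 o1 !exprD !exprS; ring.
- move=> M; rewrite /close_poly (negPf dn2) (negPf dn3) ed /= e3 dE !exprS; ring.
Qed.

(** With s = sqrt M the bound in s^(-(2d-2)) is one in M^(-(d-1)), and the
    Archimedean property turns the threshold on s into an integer one on M. *)
Lemma close_poly_real_roots (R : realType) (d : nat) : (2 <= d)%N ->
  exists C : R, exists m : int, 0 < C /\
    forall M : int, 0 < M -> m <= M ->
    exists alpha beta : R,
      [/\ 0 < alpha, beta < 0,
          root (map_poly intr (close_poly d M)) alpha,
          root (map_poly intr (close_poly d M)) beta &
          0 < `|alpha + beta| <= C / M%:~R ^+ d.-1].
Proof.
move=> d2.
have [u [v [sg [e [u0 v0 [_ e1] idt dec]]]]] := close_poly_decomposition d2.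
pose toR := map_poly (intr : int -> R).
have hor (p : {poly int}) (x : int) : (toR p).[x%:~R] = (p.[x])%:~R.
  by rewrite horner_map.
have [||||s0 hs0] := @close_opposite_roots R (toR u) (toR v) e%:~R (d - 2).
- by rewrite -[0](rmorph0 (intr : {rmorphism int -> R})) hor u0.
- by rewrite -[0](rmorph0 (intr : {rmorphism int -> R})) hor v0.
- by rewrite -intr_norm e1.
- move=> x; have /(congr1 (fun p => (toR p).[x])) := idt.
  rewrite /toR rmorphB !rmorphM /= !map_comp_poly rmorphN /= map_polyX.
  rewrite map_polyXn map_polyC /= !hornerE !horner_comp !hornerE.
  by rewrite map_polyC /= hornerC.
exists (2 ^+ ((d - 2).*2 + 5)), ((Num.bound (s0 ^+ 2))%:Z).
split=> [|M M0 mM]; first exact: exprn_gt0.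
have MR0 : 0 < M%:~R :> R by rewrite ltr0z.
set s := Num.sqrt (M%:~R : R).
have sM : s ^+ 2 = M%:~R by rewrite sqr_sqrtr // ltW.
have s_gt0 : 0 < s by rewrite sqrtr_gt0.
have s0s : s0 <= s.
  have [s00|s00] := lerP s0 0; first by apply: le_trans s00 (ltW s_gt0).
  rewrite -(ler_pXn2r (isT : (0 < 2)%N)) ?nnegrE ?(ltW s00) ?(ltW s_gt0) // sM.
  apply: le_trans (ltW (archi_boundP (sqr_ge0 s0))) _.
  by rewrite -[X in X <= _]/((Num.bound (s0 ^+ 2))%:Z%:~R) ler_int.
have [a [g [a0 g0 ha hg hag]]] := hs0 s s0s s_gt0.
have rootE (x : R) : (s ^+ 2 * x ^+ 2 - 1) * (toR u).[x] = (toR v).[x] ->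
    root (toR (close_poly d M)) x.
  move=> hx; apply/rootP; rewrite dec /toR.
  rewrite !(rmorphM, rmorphB) /= rmorph1 !map_polyC map_polyX /=.
  by rewrite !hornerE -sM -hx [x ^+ 2]expr2 mulrA subrr mulr0.
exists a, (- g); split => //.
- by rewrite oppr_lt0.
- exact: rootE.
- by apply: rootE; rewrite sqrrN.
suff -> : M%:~R ^+ d.-1 = s ^+ ((d - 2).*2 + 2) by [].
by rewrite -sM -exprM; congr (_ ^+ _); lia.
Qed.

(** At a common root of u and v the identity of the decomposition gives
    z^(2d-3) = 0, while u(0) = 1; this is the coprimality that the general
    criterion asks for. *)
Lemma close_poly_irreducible (d : nat) : (3 <= d)%N ->
  exists M0 : int, forall M : int, 0 < M -> M0 <= M ->
    irreducible_poly (map_poly (intr : int -> rat) (close_poly d M)).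
Proof.
move=> d3; have d2 := ltnW d3.
have [u [v [sg [e [u0 v0 [sg1 e1] idt dec]]]]] := close_poly_decomposition d2.
pose A : {poly int} := - (sg%:P * (u + v)); pose B : {poly int} := sg%:P * ('X^2 * u).
have PE M : close_poly d M = A + M *: B.
  by rewrite dec /A /B -mul_polyC; ring.
have [|z|M M2|M0 hM0] := @irreducible_linear_family A B d 2.
- exact: ltnW.
- pose toC := map_poly (intr : int -> algC).
  have sg0 : sg%:~R != 0 :> algC by rewrite intr_eq0 -normr_eq0 sg1.
  have hA : (toC A).[z] = - (sg%:~R * ((toC u).[z] + (toC v).[z])).
    by rewrite /toC /A rmorphN rmorphM rmorphD /= map_polyC /= !hornerE.
  have hB : (toC B).[z] = sg%:~R * (z ^+ 2 * (toC u).[z]).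
    by rewrite /toC /B !rmorphM /= map_polyC map_polyX /= !hornerE.
  move=> /rootP Az; apply/negP => /rootP Bz; move: Az Bz; rewrite -/toC hA hB.
  move=> /eqP; rewrite oppr_eq0 mulf_eq0 (negPf sg0) /= => /eqP uv.
  move=> /eqP; rewrite mulf_eq0 (negPf sg0) /= mulf_eq0 expf_eq0 /= => zu.
  have hor (p : {poly int}) (x : int) : (toC p).[x%:~R] = (p.[x])%:~R.
    by rewrite horner_map.
  have z0 : z != 0.
    apply/negP => /eqP z0; move: uv; rewrite z0.
    rewrite -[0](rmorph0 (intr : {rmorphism int -> algC})).
    by rewrite !hor u0 v0 addr0 => /eqP; rewrite intr_eq0.
  move: zu; rewrite (negPf z0) /= => /eqP uz.
  move: uv; rewrite uz add0r => vz.
  have /(congr1 (fun p => (toC p).[z])) := idt.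
  rewrite /toC rmorphB !rmorphM /= map_polyXn map_polyC /= -/toC !hornerE.
  rewrite uz vz mul0r mulr0 subr0 => /esym/eqP.
  rewrite mulf_eq0 expf_eq0 (negPf z0) andbF orbF mulf_eq0 /toC.
  rewrite map_polyC hornerC /= !intr_eq0.
  by rewrite -[e == 0]normr_eq0 e1.
- have M0 : 0 < M by lia.
  have [hc _ _ _ hd] := close_poly_coefs d2 M0; rewrite -PE; split => //.
  + exact: close_poly_monic.
  + exact: close_poly_size.
  + by have := hd d3; move: `|_| => y; lia.
by exists M0 => M _ MM0; rewrite PE; apply: hM0.
Qed.

Theorem theorem3 (R : realType) (d : nat) (hd : (2 <= d)%N) :
  [/\ forall M : int, 0 < M ->
        size (close_poly d M) = d.+1 /\ (height (close_poly d M))%:Z = M,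
      exists (C : R) (Md : int), 0 < C /\
        forall M : int, 0 < M -> Md <= M ->
        exists alpha beta : R,
          [/\ alpha != beta,
              root (map_poly intr (close_poly d M)) alpha,
              root (map_poly intr (close_poly d M)) beta,
              `| `|alpha| - `|beta| | = `|alpha + beta| &
              0 < `|alpha + beta|
                <= C * (height (close_poly d M))%:R ^ (- d%:Z + 1)]
    & (3 <= d)%N ->
        (forall M : int, 0 < M -> close_poly d M \is monic) /\
        exists M0 : int, forall M : int, 0 < M -> M0 <= M ->
          irreducible_poly (map_poly (intr : int -> rat) (close_poly d M))].
Proof.
split.
- by move=> M M0; rewrite close_poly_size // close_poly_height.
- have [C [m [C0 hC]]] := close_poly_real_roots R hd.
  exists C, m; split=> // M M0 mM.
  have [a [b [a0 b0 ra rb hab]]] := hC M M0 mM; exists a, b; split => //.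
  + by rewrite gt_eqF // (lt_trans b0).
  + by rewrite (gtr0_norm a0) (ltr0_norm b0) opprK.
  + have -> : - d%:Z + 1 = - (d.-1)%:Z by lia.
    by rewrite -[_%:R]/((height (close_poly d M))%:Z%:~R) close_poly_height // -exprnN.
- move=> d3; split; first by move=> M; apply: close_poly_monic.
  exact: close_poly_irreducible.
Qed.
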